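(* Let $a\in\mathbb{D}$ and $f,g\in\mathcal{H}$. Then 1. $f\in N(R_a-I)$ if and only if $|1-\bar a z|^{1/2}f\in N(C_a-I)$. 2. $g\in N(R_a+I)$ if and only if $|1-\bar a z|^{1/2}g\in N(C_a+I)$.
   Context: $\mathbb{D}=\{z\in\mathbb{C}:|z|<1\}$, $\mathbb{T}=\{z\in\mathbb{C}:|z|=1\}$, and $\mathcal{H}=L^2(\mathbb{T})$ with respect to normalized Lebesgue measure. For $a\in\mathbb{D}$, $\varphi_a(z)=\frac{a-z}{1-\bar a z}$ and $C_a:\mathcal{H}\to\mathcal{H}$ is the bounded composition operator $C_af=f\circ\varphi_a$ (so $C_a^2=I$). $M_h$ denotes multiplication by $h$. $R_a$ is the unitary part in the polar decomposition $C_a=R_a|C_a|$; explicitly $R_a=(1-|a|^2)^{1/2}M_{\frac{1}{|1-\bar a z|}}C_a$, and $R_a$ is a symmetry ($R_a^*=R_a=R_a^{-1}$). $N(T)$ denotes the nullspace of $T$. *)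

(* Defs.v *)
From HB Require Import structures.
From mathcomp Require Import all_boot all_order all_algebra.
From mathcomp Require Import all_classical all_reals all_analysis.
From mathcomp Require Import measurable_realfun.
From mathcomp Require Import complex.

Set Implicit Arguments.
Unset Strict Implicit.
Unset Printing Implicit Defensive.

Import Order.TTheory GRing.Theory Num.Theory numFieldNormedType.Exports.

Local Open Scope classical_set_scope.
Local Open Scope ring_scope.

Record disk (R : realType) : Type :=
  Disk { disk_val :> R[i] ; disk_lt1 : `|disk_val| < 1 }.

Record circle (R : realType) : Type :=
  Circle { circle_val :> R[i] ; circle_norm1 : `|circle_val| == 1 }.

HB.instance Definition _ (R : realType) := [isSub for @circle_val R].
HB.instance Definition _ (R : realType) := [Choice of circle R by <:].

Section circle_measurable.
Context {R : realType}.

Let norm_one : `|1 : R[i]| == 1. Proof. by rewrite normr1. Qed.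

HB.instance Definition _ := isPointed.Build (circle R) (Circle norm_one).

(* The Borel sigma-algebra of the circle is the trace of that of R x R. *)
Definition circle_coord (z : circle R) : R * R :=
  (complex.Re z, complex.Im z).

HB.instance Definition _ :=
  Measurable.copy (circle R) (g_sigma_algebra_preimageType circle_coord).

Fact norm_expi (t : R) : `|cos t +i* sin t|%C == 1.
Proof. by rewrite normc_def /= cos2Dsin2 sqrtr1. Qed.

Definition expi (t : measurableTypeR R) : circle R := Circle (norm_expi t).

Fact measurable_expi : measurable_fun [set: measurableTypeR R] expi.
Proof.
move=> _ _ [B mB] <-; rewrite !setTI -comp_preimage -[X in measurable X]setTI.
have: measurable_fun [set: measurableTypeR R] (circle_coord \o expi); last by apply.
apply/measurable_fun_pairP; split.
  apply: continuous_measurable_fun; exact: continuous_cos.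
apply: continuous_measurable_fun; exact: continuous_sin.
Qed.

HB.instance Definition _ :=
  isMeasurableFun.Build _ _ _ _ expi measurable_expi.

Fact pi2_gt0 : 0 < pi *+ 2 :> R.
Proof. by rewrite mulrn_wgt0// pi_gt0. Qed.

End circle_measurable.

(* Normalized Lebesgue measure: the image of the uniform probability on
   [0, 2 pi] under t |-> e^(it). *)
Definition circle_measure (R : realType) : probability (circle R) R :=
  distribution (uniform_prob (@pi2_gt0 R)) expi.

(* Elements of L^2(T) are represented by square-integrable functions, equality
   being equality almost everywhere; operators on L^2(T) are represented by
   maps between functions, of which only the behaviour on square-integrable
   functions, up to almost everywhere equality, is relevant. *)
Definition cfun (R : realType) : Type := circle R -> R[i].
Definition operator (R : realType) : Type := cfun R -> cfun R.

Section L2.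
Context {R : realType}.
Implicit Types (f g : cfun R) (A B U P : operator R).

Definition L2 f : Prop :=
  [/\ measurable_fun setT (fun z => complex.Re (f z)),
      measurable_fun setT (fun z => complex.Im (f z)) &
      (\int[circle_measure R]_z (complex.Re `|f z| ^+ 2)%:E < +oo)%E].

Definition cintegral f : R[i] :=
  ((\int[circle_measure R]_z complex.Re (f z)) +i* (\int[circle_measure R]_z complex.Im (f z)))%C.

Definition inner f g : R[i] := cintegral (fun z => f z * (g z)^*).

Definition L2norm f : R := Num.sqrt (\int[circle_measure R]_z complex.Re `|f z| ^+ 2).

Record bounded_operator A : Prop := BoundedOperator {
  operator_L2 : forall f, L2 f -> L2 (A f) ;
  operator_ae : forall f g, L2 f -> L2 g ->
    f = g %[ae circle_measure R] -> A f = A g %[ae circle_measure R] ;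
  operator_linear : forall (c : R[i]) f g, L2 f -> L2 g ->
    A (fun z => c * f z + g z) = (fun z => c * A f z + A g z) %[ae circle_measure R] ;
  operator_bounded : exists M : R, forall f, L2 f ->
    L2norm (A f) <= M * L2norm f
}.

Definition is_adjoint A B : Prop :=
  bounded_operator B /\
  forall f g, L2 f -> L2 g -> inner (A f) g = inner f (B g).

Definition unitary_operator U : Prop :=
  bounded_operator U /\
  exists2 V, is_adjoint U V & forall f, L2 f ->
    V (U f) = f %[ae circle_measure R] /\ U (V f) = f %[ae circle_measure R].

(* In R[i], [0 <= z] says that z is real and nonnegative. *)
Definition positive_operator P : Prop :=
  bounded_operator P /\ forall f, L2 f -> 0 <= inner (P f) f.

(* P = |A| = (A^* A)^(1/2) *)
Definition is_modulus A P : Prop :=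
  positive_operator P /\
  exists2 B, is_adjoint A B & forall f, L2 f -> P (P f) = B (A f) %[ae circle_measure R].

(* U is the unitary part in the polar decomposition A = U |A| *)
Definition polar_unitary_part A U : Prop :=
  unitary_operator U /\
  exists2 P, is_modulus A P & forall f, L2 f -> A f = U (P f) %[ae circle_measure R].

Definition nullspace A : set (cfun R) :=
  [set f | L2 f /\ A f = (0 : cfun R) %[ae circle_measure R]].

End L2.

Section composition.
Context {R : realType}.

Definition moebius_fun (a z : R[i]) : R[i] := (a - z) / (1 - a^* * z).

Fact norm_moebius (a : disk R) (z : circle R) : `|moebius_fun a z| == 1.
Proof.
case: a z => a a1 [z /= z1]; move/eqP in z1; rewrite /moebius_fun /=.
have -> : 1 - a^* * z = z * (z - a)^*.
  by rewrite rmorphB mulrBr -normCK z1 expr1n [z * _]mulrC.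
rewrite normf_div normrM z1 mul1r norm_conjC distrC divff// normr_eq0 subr_eq0.
by apply/eqP => za; move: a1; rewrite -za z1 ltxx.
Qed.

Definition moebius (a : disk R) (z : circle R) : circle R :=
  Circle (norm_moebius a z).

Definition composition (a : disk R) : operator R := fun f => f \o moebius a.

End composition.

(* Main.v *)
From HB Require Import structures.
Require Import Defs.
From mathcomp Require Import all_boot all_order all_algebra.
From mathcomp Require Import all_classical all_reals all_analysis.
From mathcomp Require Import measurable_realfun complex ring lra.
Set Implicit Arguments.
Unset Strict Implicit.
Unset Printing Implicit Defensive.
Import Order.TTheory GRing.Theory Num.Theory numFieldNormedType.Exports.
Local Open Scope classical_set_scope.
Local Open Scope ring_scope.

(** The operator [composition a] has modulus the multiplication by [q], where
    [q ^ 2] is the Poisson kernel [(1 - |a|^2) / |1 - conj a z|^2], and its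
    polar part therefore sends [g] to [q * (g o phi)], [phi] being the Moebius
    involution attached to [a].  With [W = |1 - conj a z|^(1/2)] one has
    [W o phi = q * W], so that [(W g) o phi = W * (q * (g o phi))]:
    multiplication by the nowhere vanishing [W] intertwines the polar part and
    the composition operator, and matches their eigenvectors for the eigenvalues
    1 and -1.

    Two facts carry the identification of the polar part.

    The first is the change of variables [Rintegral_moebius]: the image of the
    circle measure under [phi] has the Poisson kernel as density.  On the real
    line [phi] lifts to an explicit increasing function [moebius_lift], which
    commutes with the translation by [2 pi] and has the Poisson kernel as
    derivative; the substitution rule [lebesgue_measure_substitution] for Borel
    sets and the periodicity of the sets pulled back from the circle give the
    result.  It implies that [C^* C], with [C = composition a], is the
    multiplication by the Poisson kernel.

    The second is [positive_square_root_unique]: a bounded positive [P] whose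
    square is the multiplication by [q ^ 2], with [0 < m <= q <= L], is the
    multiplication by [q].  Put [D = P - q].  From [P P = q ^ 2] one gets
    [D (L - q) = (L + P) D], and positivity of [P] makes [L + P] expand norms by
    at least [L].  Hence
    [L ^ n |D f| <= |D ((L - q) ^ n f)| <= C (L - m) ^ n |f|] for all [n],
    which forces [D f = 0]. *)

(** * The Poisson kernel and the lift of a Moebius map to the line *)

Lemma cos_atan_mulr2n (R : realType) (r : R) :
  cos (atan r *+ 2) = (1 - r ^+ 2) / (1 + r ^+ 2).
Proof.
have r1 : 0 < 1 + r ^+ 2 by rewrite ltr_wpDr ?sqr_ge0.
rewrite cos_mulr2n cos_atan exprVn sqr_sqrtr ?ltW//.
have r0 : 1 + r ^+ 2 != 0 by rewrite gt_eqF.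
by field.
Qed.

Lemma sin_atan_mulr2n (R : realType) (r : R) :
  sin (atan r *+ 2) = r *+ 2 / (1 + r ^+ 2).
Proof.
have r1 : 0 < 1 + r ^+ 2 by rewrite ltr_wpDr ?sqr_ge0.
have c0 : cos (atan r) != 0 by rewrite cos_atan invr_eq0 sqrtr_eq0 -ltNge.
rewrite sin_mulr2n !mulr2n -[in RHS](atanK r) /tan.
have -> : (1 + (sin (atan r) / cos (atan r)) ^+ 2) = (cos (atan r) ^+ 2)^-1.
  apply: (mulIf (expf_neq0 2 c0)).
  by rewrite mulVf ?expf_neq0// mulrDl mul1r -exprMn divfK// cos2Dsin2.
by field.
Qed.

Section PoissonKernel.
Context {R : realType}.
Variable a : disk R.
Local Notation p := (complex.Re (a : R[i])).
Local Notation s := (complex.Im (a : R[i])).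

Lemma Re_sqr_norm (z : R[i]) :
  complex.Re (`|z| ^+ 2) = complex.Re z ^+ 2 + complex.Im z ^+ 2.
Proof. by rewrite -add_Re2_Im2. Qed.

Lemma circle_coordE (z : circle R) :
  complex.Re (z : R[i]) ^+ 2 + complex.Im (z : R[i]) ^+ 2 = 1.
Proof. by case: z => z /= /eqP z1; rewrite -Re_sqr_norm z1 expr1n. Qed.

Definition poisson_num : R := 1 - p ^+ 2 - s ^+ 2.

Lemma poisson_num_gt0 : 0 < poisson_num.
Proof.
rewrite /poisson_num; case: a => -[x y] /= a1.
have : `|(x +i* y)%C| ^+ 2 < 1 by rewrite expr_lt1.
by rewrite -add_Re2_Im2 /= -[1]/(1%:C)%C ltcR -addrA -opprD subr_gt0.
Qed.

Definition poisson_den (z : R[i]) : R :=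
  complex.Re (`|1 - (a : R[i])^* * z| ^+ 2).

Lemma poisson_denC (z : R[i]) :
  (poisson_den z)%:C%C = `|1 - (a : R[i])^* * z| ^+ 2.
Proof. by rewrite /poisson_den Re_sqr_norm add_Re2_Im2. Qed.

Lemma one_sub_conj_mulE (z : R[i]) : 1 - (a : R[i])^* * z =
  ((1 - p * complex.Re z - s * complex.Im z) -i*
   (p * complex.Im z - s * complex.Re z))%C.
Proof.
case: a z => -[x y] /= _ [u v] /=.
by apply/eqP; rewrite eq_complex /=; apply/andP; split; apply/eqP; ring.
Qed.

Lemma poisson_denE z : poisson_den z =
  (1 - p * complex.Re z - s * complex.Im z) ^+ 2 +
  (p * complex.Im z - s * complex.Re z) ^+ 2.
Proof.
by rewrite /poisson_den Re_sqr_norm one_sub_conj_mulE /= sqrrN.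
Qed.

(** [1 - conj a z] stays in the right half-plane, so that its argument is the
    arctangent of the quotient of its coordinates: this makes the lift below
    smooth on the whole line. *)
Lemma circle_half_plane (z : circle R) :
  0 < 1 - p * complex.Re (z : R[i]) - s * complex.Im (z : R[i]).
Proof.
have := poisson_num_gt0; have := circle_coordE z; rewrite /poisson_num.
move: (complex.Re _) (complex.Im _) p s => x y q t xy qt.
have : (q * x + t * y) ^+ 2 + (q * y - t * x) ^+ 2 < 1.
  have -> : (q * x + t * y) ^+ 2 + (q * y - t * x) ^+ 2 =
    (q ^+ 2 + t ^+ 2) * (x ^+ 2 + y ^+ 2) by ring.
  by rewrite xy; lra.
by have := sqr_ge0 (q * y - t * x); nra.
Qed.

Lemma poisson_den_gt0 (z : circle R) : 0 < poisson_den z.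
Proof.
rewrite poisson_denE; apply: ltr_wpDr; first exact: sqr_ge0.
by rewrite exprn_gt0// circle_half_plane.
Qed.

Lemma poisson_den_le4 (z : circle R) : poisson_den z <= 4.
Proof.
have := poisson_num_gt0; have := circle_coordE z.
rewrite /poisson_num poisson_denE.
move: (complex.Re _) (complex.Im _) p s => x y q t xy qt.
have -> : (1 - q * x - t * y) ^+ 2 + (q * y - t * x) ^+ 2 =
  1 + (q ^+ 2 + t ^+ 2) * (x ^+ 2 + y ^+ 2) - (q * x + t * y) *+ 2 by ring.
by rewrite xy; have := sqr_ge0 (q + x); have := sqr_ge0 (t + y); lra.
Qed.

Definition poisson (z : circle R) : R := poisson_num / poisson_den z.

(** [1 - conj a e^(it) = lift_den t - i lift_num t]. *)
Definition lift_num (t : R) : R := p * sin t - s * cos t.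
Definition lift_den (t : R) : R := 1 - p * cos t - s * sin t.

(** With [w = 1 - conj a z] and [|z| = 1], [a - z = - z (conj w)], so that
    [phi z = - z (conj w / w)] has argument [t + pi - 2 arg w] at [z = e^(it)]. *)
Definition moebius_lift (t : R) : R :=
  t + pi + atan (lift_num t / lift_den t) *+ 2.

Lemma lift_den_gt0 t : 0 < lift_den t.
Proof. exact: (circle_half_plane (expi t)). Qed.

Lemma expi_moebius_lift t : expi (moebius_lift t) = moebius a (expi t).
Proof.
apply/val_inj => /=; rewrite /moebius_fun.
set w := 1 - _ * _.
have w0 : w != 0.
  apply/eqP => w0; have := poisson_den_gt0 (expi t).
  have -> : poisson_den (expi t) = complex.Re (`|w| ^+ 2) by [].
  by rewrite w0 normr0 expr0n ltxx.
apply: (mulIf w0); rewrite divfK//.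
have u0 := lift_den_gt0 t.
have D0 : lift_den t ^+ 2 + lift_num t ^+ 2 != 0.
  by rewrite gt_eqF// ltr_wpDr ?sqr_ge0// exprn_gt0.
have := cos2Dsin2 t.
rewrite /moebius_lift (cosD (t + pi)) (sinD (t + pi)) cosDpi sinDpi.
rewrite cos_atan_mulr2n sin_atan_mulr2n.
have -> : w = (lift_den t -i* lift_num t)%C.
  by rewrite /w one_sub_conj_mulE.
set c := cos t; set d := sin t => cd.
have -> : (a : R[i]) = (p +i* s)%C by case: a => -[].
apply/eqP; rewrite eq_complex /=; apply/andP; split; apply/eqP.
  transitivity (- c * lift_den t + d * lift_num t).
    by field; rewrite D0 gt_eqF.
  rewrite /lift_den /lift_num -/c -/d.
  transitivity (- c + p * (c ^+ 2 + d ^+ 2)); first by ring.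
  by rewrite cd; ring.
transitivity (- c * lift_num t - d * lift_den t).
  by field; rewrite D0 gt_eqF.
rewrite /lift_den /lift_num -/c -/d.
transitivity (- d + s * (c ^+ 2 + d ^+ 2)); first by ring.
by rewrite cd; ring.
Qed.

Lemma is_derive_moebius_lift (t : R) :
  is_derive t 1 moebius_lift (poisson (expi t)).
Proof.
have u0 := lift_den_gt0 t; have u0' : lift_den t != 0 by rewrite gt_eqF.
have dn : is_derive t (1 : R) lift_num (p *: cos t - s *: - sin t).
  rewrite (_ : lift_num = p *: sin - s *: cos); last by apply/funext => y.
  exact: is_deriveB.
have dd : is_derive t (1 : R) lift_den (0 - p *: - sin t - s *: cos t).
  rewrite (_ : lift_den = cst 1 - p *: cos - s *: sin).
    exact: is_deriveB.
  by apply/funext => y.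
have dr := is_deriveM dn (is_deriveV u0' dd).
have da := @is_derive1_comp _ (@atan R) _ _ _ _ (is_derive1_atan _) dr.
pose r := lift_num * (fun y : R => (lift_den y)^-1).
rewrite (_ : moebius_lift =
    (id + cst pi) + ((@atan R \o r) + (@atan R \o r))); last first.
  by apply/funext => y; rewrite /moebius_lift mulr2n.
have did :=
  is_deriveD (is_derive_id t (1 : R)) (is_derive_cst (pi : R) t (1 : R)).
have dS := is_deriveD did (is_deriveD da da).
apply: (is_derive_eq dS).
rewrite /poisson poisson_denE /= -/(lift_den t) -/(lift_num t) /poisson_num.
rewrite /GRing.scale /= fctE -/(lift_den t).
have D0 : lift_den t ^+ 2 + lift_num t ^+ 2 != 0.
  by rewrite gt_eqF// ltr_wpDr ?sqr_ge0// exprn_gt0.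
have -> : p * cos t - s * - sin t = 1 - lift_den t by rewrite /lift_den; ring.
have -> : 0 - p * - sin t - s * cos t = lift_num t by rewrite /lift_num; ring.
have -> : 1 - p ^+ 2 - s ^+ 2 =
    lift_den t + lift_den t - (lift_den t ^+ 2 + lift_num t ^+ 2).
  rewrite /lift_den /lift_num.
  transitivity (1 - (p ^+ 2 + s ^+ 2) * (cos t ^+ 2 + sin t ^+ 2)); last by ring.
  by rewrite cos2Dsin2; ring.
have D1 : 1 + (lift_num t / lift_den t) ^+ 2 != 0.
  by rewrite gt_eqF// ltr_wpDr ?sqr_ge0.
by field; rewrite u0' D0.
Qed.

Lemma poisson_gt0 z : 0 < poisson z.
Proof. by rewrite divr_gt0 ?poisson_num_gt0 ?poisson_den_gt0. Qed.

Lemma derivable_moebius_lift t : derivable moebius_lift t 1.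
Proof. by have [] := is_derive_moebius_lift t. Qed.

Lemma derive1_moebius_lift : derive1 moebius_lift = poisson \o expi.
Proof.
apply/funext => t; rewrite derive1E.
by have [] := is_derive_moebius_lift t.
Qed.

Lemma continuous_moebius_lift : continuous moebius_lift.
Proof.
by move=> t; apply/differentiable_continuous/derivable1_diffP/derivable_moebius_lift.
Qed.

Lemma continuous_poisson_expi : continuous (fun t : R => poisson (expi t)).
Proof.
have -> : (fun t : R => poisson (expi t)) =
    (fun t =>
       poisson_num / (lift_den t * lift_den t + lift_num t * lift_num t)).
  by apply/funext => t; rewrite /poisson poisson_denE -!expr2.
have cn : continuous lift_num.
  move=> t; apply: cvgB; apply: cvgMr.
    exact: continuous_sin.
  exact: continuous_cos.
have cd : continuous lift_den.
  move=> t; apply: cvgB; last by apply: cvgMr; exact: continuous_sin.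
  apply: cvgB; first exact: cvg_cst.
  by apply: cvgMr; exact: continuous_cos.
move=> t; apply: cvgMr; apply: cvgV.
  by rewrite -!expr2 gt_eqF// ltr_wpDr ?sqr_ge0// exprn_gt0// lift_den_gt0.
by apply: cvgD; apply: cvgM; [exact: cd|exact: cd|exact: cn|exact: cn].
Qed.

Lemma moebius_lift_lt : {homo moebius_lift : x y / x < y}.
Proof.
move=> x y xy.
have d1 t : t \in `]x, y[ -> derivable moebius_lift t 1.
  by move=> _; exact: derivable_moebius_lift.
have d2 t : t \in `]x, y[ -> 0 < derive1 moebius_lift t.
  by move=> _; rewrite derive1_moebius_lift poisson_gt0.
have d3 : {within `[x, y], continuous moebius_lift}.
  exact/continuous_subspaceT/continuous_moebius_lift.
by apply: (gtr0_derive1_lt_cc d1 d2 d3) => //; rewrite in_itv /= lexx (ltW xy).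
Qed.

(** The arctangent lies in [(- pi / 2, pi / 2)]: together with continuity this
    bound makes the lift onto, and it places [moebius_lift 0] in one period. *)
Lemma moebius_lift_bounds t : t < moebius_lift t < t + pi *+ 2.
Proof.
have := atan_gtNpi2 (lift_num t / lift_den t).
have := atan_ltpi2 (lift_num t / lift_den t).
by rewrite /moebius_lift; lra.
Qed.

Lemma moebius_liftD2pi t : moebius_lift (t + pi *+ 2) = moebius_lift t + pi *+ 2.
Proof.
rewrite /moebius_lift /lift_num /lift_den cosD2pi sinD2pi.
by rewrite [t + _ + _]addrAC [LHS]addrAC.
Qed.

Lemma moebius_lift_surj y : exists x, moebius_lift x = y.
Proof.
have [|||x _ <-] := @IVT R moebius_lift (y - pi *+ 2) y y; last by exists x.
- by rewrite gerBl mulrn_wge0// pi_ge0.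
- exact/continuous_subspaceT/continuous_moebius_lift.
- have /andP[l1 _] := moebius_lift_bounds y.
  have /andP[_ +] := moebius_lift_bounds (y - pi *+ 2).
  by rewrite subrK => l2; rewrite ge_min (ltW l2) le_max (ltW l1) orbT.
Qed.

End PoissonKernel.

(** * Substitution in the Lebesgue measure of Borel sets *)

Section Density.
Local Open Scope ereal_scope.
Context d (T : measurableType d) (R : realType).
Variable mu : {measure set T -> \bar R}.

(** The proofs [h0] and [mh] are arguments so that the measure structure can be
    inferred from the term. *)
Definition density (h : T -> R) (h0 : forall x, (0 <= h x)%R)
    (mh : measurable_fun setT h) (A : set T) : \bar R :=
  \int[mu]_(x in A) (h x)%:E.

Variables (h : T -> R) (h0 : forall x, (0 <= h x)%R)
  (mh : measurable_fun setT h).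

Let density_set0 : density h0 mh set0 = 0.
Proof. by rewrite /density integral_set0. Qed.

Let density_ge0 A : 0 <= density h0 mh A.
Proof. by apply: integral_ge0 => x _; rewrite lee_fin. Qed.

Let density_sigma_additive : semi_sigma_additive (density h0 mh).
Proof.
move=> F mF tF mUF; rewrite /density; apply: cvg_toP.
  apply: ereal_nondecreasing_is_cvgn => m n mn.
  by apply: lee_sum_nneg_natr => // k _ _; exact: density_ge0.
rewrite ge0_integral_bigcup//=.
- by apply: measurable_funTS; apply/measurable_EFinP.
- by move=> x _; rewrite lee_fin.
Qed.

HB.instance Definition _ := isMeasure.Build _ _ _ (density h0 mh)
  density_set0 density_ge0 density_sigma_additive.

End Density.

Section Substitution.
Local Open Scope ereal_scope.
Context {R : realType}.
Local Notation lambda := (@lebesgue_measure R).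
Implicit Types (F : R -> R) (S : set (measurableTypeR R)).

(** The image under [F] of the measure of density [F'] gives the half-open
    interval from [F x1] to [F x2] the mass [F x2 - F x1], by the fundamental
    theorem of calculus; a measure with this property is the Lebesgue measure. *)
Lemma lebesgue_measure_substitution F S :
  {homo F : x y / (x < y)%R} -> (forall y, exists x, F x = y) ->
  (forall x, derivable F x 1) -> continuous (derive1 F) ->
  (forall x, 0 <= derive1 F x)%R -> measurable S ->
  \int[lambda]_(x in F @^-1` S) (derive1 F x)%:E = lambda S.
Proof.
move=> F_lt F_surj dF cF' F'0 mS.
have cF : continuous F.
  by move=> t; apply/differentiable_continuous/derivable1_diffP/dF.
have mF : measurable_fun [set: measurableTypeR R] (F : _ -> measurableTypeR R).
  exact: continuous_measurable_fun.
have mF' : measurable_fun [set: measurableTypeR R] (derive1 F).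
  exact: continuous_measurable_fun.
have F_le : {mono F : x y / (x <= y)%R} by exact: le_mono.
have F_lt' : {mono F : x y / (x < y)%R} by exact: leW_mono.
change (pushforward (density lambda F'0 mF')
  (F : _ -> measurableTypeR R) S = lambda S).
apply/esym/lebesgue_measure_unique => //= _ [[y1 y2]] _ <-.
have [x1 <-] := F_surj y1; have [x2 <-] := F_surj y2.
rewrite /pushforward /density /= lebesgue_measure_itv /= lte_fin F_lt'.
have -> : F @^-1` `]F x1, F x2]%classic = `]x1, x2]%classic.
  by apply/seteqP; split => x /=; rewrite !in_itv /= F_lt' F_le.
case: ltP => [x12|x21]; last first.
  by rewrite set_itv_ge ?integral_set0// bnd_simp -leNgt.
rewrite integral_itv_obnd_cbnd; last first.
  by apply: measurable_funTS; exact/measurable_EFinP.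
have FTC_diff : derivable_oo_LRcontinuous F x1 x2.
  split; first by move=> x _; exact: dF.
    exact/cvg_at_right_filter/cF.
  exact/cvg_at_left_filter/cF.
have FTC_cont : {within `[x1, x2], continuous (derive1 F)}.
  exact: continuous_subspaceT.
by rewrite (continuous_FTC2 x12 FTC_cont FTC_diff).
Qed.

Lemma lebesgue_measure_translation (c : R) S : measurable S ->
  lambda ((fun x => x + c)%R @^-1` S) = lambda S.
Proof.
move=> mS; have dF x : is_derive (x : R) (1 : R)%R (fun x => x + c)%R (1 : R)%R.
  rewrite -[X in is_derive _ _ _ X]addr0; apply: is_deriveD.
have F'1 : derive1 (fun x => x + c)%R = cst (1 : R)%R :> (R -> R).
  by apply/funext => x; rewrite derive1E; have [] := dF x.
have mcS : measurable ((fun x : measurableTypeR R => x + c)%R @^-1` S).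
  rewrite -[X in measurable X]setTI.
  have mF : measurable_fun [set: measurableTypeR R]
      (fun x : measurableTypeR R => (x + c)%R : measurableTypeR R).
    exact: measurable_funD.
  exact: mF measurableT _ mS.
rewrite -[RHS](@lebesgue_measure_substitution (fun x => x + c)%R)//.
- by rewrite F'1 -[LHS]mul1e; apply/esym/(integral_cst _ mcS 1%:E).
- by move=> x y; rewrite ltrD2r.
- by move=> y; exists (y - c)%R; rewrite subrK.
- by rewrite F'1; exact: cst_continuous.
- by rewrite F'1.
Qed.

(** The window is cut at [T], and the part beyond [T] is moved back by [T]. *)
Lemma lebesgue_measure_periodic (T c : R) S : measurable S ->
  (forall x, S (x + T)%R <-> S x) -> (0 <= c <= T)%R ->
  lambda (S `&` `]c, (c + T)%R]%classic) = lambda (S `&` `]0%R, T]%classic).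
Proof.
move=> mS perS /andP[c0 cT].
have T0 : (0 <= T)%R := le_trans c0 cT.
rewrite (@itv_bndbnd_setU _ _ (BRight c) (BRight T) (BRight (c + T)%R));
  rewrite ?bnd_simp ?lerDr//.
rewrite (@itv_bndbnd_setU _ _ (BRight 0%R) (BRight c) (BRight T)) ?bnd_simp//.
rewrite !setIUr !measureU//; first last.
- rewrite setIACA setIid; apply/seteqP; split => // x [_ []] /=.
  rewrite !in_itv /= => /andP[_ xT] /andP[Tx _].
  by move: (lt_le_trans Tx xT); rewrite ltxx.
- exact: measurableI.
- exact: measurableI.
- rewrite setIACA setIid; apply/seteqP; split => // x [_ []] /=.
  rewrite !in_itv /= => /andP[_ xT] /andP[Tx _].
  by move: (lt_le_trans Tx xT); rewrite ltxx.
- exact: measurableI.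
- exact: measurableI.
rewrite addeC; congr (_ + _).
transitivity (lambda
    ((fun x => x + T)%R @^-1` (S `&` `]T, (c + T)%R]%classic))).
  by apply/esym/lebesgue_measure_translation; exact: measurableI.
congr (lambda _); apply/seteqP; split => x /=.
  rewrite !in_itv /= => -[/perS Sx /andP[xT xc]]; split => //.
  by rewrite -(ltrD2r T) add0r xT -(lerD2r T).
rewrite !in_itv /= => -[/perS Sx /andP[xT xc]]; split => //.
by rewrite lerD2r xc -[ltLHS]add0r ltrD2r xT.
Qed.

End Substitution.

(** * Change of variables on the circle *)

Section CircleMeasurability.
Context {R : realType}.

Lemma measurable_circle_coord : measurable_fun setT (@circle_coord R).
Proof. by move=> _ B mB; rewrite setTI; exists B => //; rewrite setTI. Qed.

Lemma measurable_Re_circle :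
  measurable_fun setT (fun z : circle R => complex.Re (z : R[i])).
Proof. exact: (measurableT_comp measurable_fst measurable_circle_coord). Qed.

Lemma measurable_Im_circle :
  measurable_fun setT (fun z : circle R => complex.Im (z : R[i])).
Proof. exact: (measurableT_comp measurable_snd measurable_circle_coord). Qed.

Lemma measurable_fun_circle d (T : measurableType d) (f : T -> circle R) :
  measurable_fun setT (fun x => complex.Re (f x : R[i])) ->
  measurable_fun setT (fun x => complex.Im (f x : R[i])) ->
  measurable_fun setT f.
Proof.
move=> mRe mIm _ _ [B mB <-].
rewrite !setTI -comp_preimage -[X in measurable X]setTI.
have: measurable_fun setT (circle_coord \o f); last by apply.
exact/measurable_fun_pairP.
Qed.

Lemma measurable_fun_inv_gt0 d (T : measurableType d) (f : T -> R) :
  (forall x, 0 < f x) -> measurable_fun setT f ->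
  measurable_fun setT (fun x => (f x)^-1).
Proof.
move=> f0 mf; rewrite (_ : (fun x => _) = (fun x => f x `^ (- 1))).
  exact: (measurableT_comp (measurable_powR _) mf).
by apply/funext => x; rewrite powR_inv1// ltW.
Qed.

(** The interval is half-open so that its preimage under an increasing bijection
    and its translates by a period tile the line. *)
Lemma integral_circle (G : circle R -> \bar R) :
  measurable_fun setT G -> (forall z, 0 <= G z)%E ->
  (\int[circle_measure R]_z G z =
   ((pi *+ 2)^-1)%:E *
     \int[lebesgue_measure]_(t in `]0%R, (pi *+ 2)%R]) G (expi t))%E.
Proof.
move=> mG G0.
have mGe : measurable_fun setT (G \o @expi R).
  exact: measurableT_comp mG measurable_expi.
rewrite /circle_measure /distribution ge0_integral_pushforward//.
rewrite preimage_setT (integral_uniform _ mGe)//; last by move=> t; exact: G0.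
by rewrite subr0 integral_itv_obnd_cbnd//; exact: measurable_funTS.
Qed.

End CircleMeasurability.

Section MoebiusChangeOfVariables.
Context {R : realType}.
Variable a : disk R.
Local Notation mu := (circle_measure R).

Lemma one_sub_conj_mul_neq0 (z : circle R) : 1 - (a : R[i])^* * (z : R[i]) != 0.
Proof.
apply/eqP => w0; have := poisson_den_gt0 a z.
by rewrite /poisson_den w0 normr0 expr0n ltxx.
Qed.

Lemma poisson_numE : (poisson_num a)%:C%C = 1 - (a : R[i])^* * (a : R[i]).
Proof.
rewrite one_sub_conj_mulE /poisson_num.
by apply/eqP; rewrite eq_complex /=; apply/andP; split; apply/eqP; ring.
Qed.

Lemma one_sub_conj_moebius (z : circle R) :
  1 - (a : R[i])^* * (moebius a z : R[i]) =
  (poisson_num a)%:C%C / (1 - (a : R[i])^* * (z : R[i])).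
Proof.
have w0 := one_sub_conj_mul_neq0 z.
rewrite /= /moebius_fun; apply: (mulIf w0); rewrite divfK//.
rewrite mulrBl mul1r -mulrA divfK// mulrBr.
by rewrite poisson_numE; ring.
Qed.

Lemma moebiusK : involutive (moebius a).
Proof.
move=> z; apply/val_inj; rewrite /= [LHS]/moebius_fun.
rewrite (one_sub_conj_moebius z) /= /moebius_fun.
have w0 := one_sub_conj_mul_neq0 z.
have k0 : (poisson_num a)%:C%C != 0.
  by rewrite -[0]/(0%:C)%C (inj_eq (@complexI R)) gt_eqF// poisson_num_gt0.
rewrite poisson_numE in k0 *; field.
by rewrite w0 k0.
Qed.

Lemma poisson_den_moebius (z : circle R) :
  poisson_den a (moebius a z) = poisson_num a ^+ 2 / poisson_den a z.
Proof.
have D0 := poisson_den_gt0 a z.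
apply: (@complexI R); rewrite rmorphM fmorphV rmorphXn /= !poisson_denC.
rewrite one_sub_conj_moebius normf_div exprMn exprVn.
rewrite (ger0_norm (_ : 0 <= (poisson_num a)%:C%C))//.
by rewrite ler0c ltW// poisson_num_gt0.
Qed.

(** Since [phi] inverts the Poisson kernel, an upper bound of [poisson_den]
    bounds the kernel on both sides. *)
Lemma poisson_le (z : circle R) : poisson a z <= 4 / poisson_num a.
Proof.
have k0 := poisson_num_gt0 a; have D0 := poisson_den_gt0 a z.
have := poisson_den_le4 a (moebius a z).
rewrite poisson_den_moebius /poisson => D4.
have -> : poisson_num a / poisson_den a z =
    poisson_num a ^+ 2 / poisson_den a z / poisson_num a.
  by field; rewrite !gt_eqF.
by rewrite ler_wpM2r// invr_ge0 ltW.
Qed.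

Lemma poisson_ge (z : circle R) : poisson_num a / 4 <= poisson a z.
Proof.
have k0 := poisson_num_gt0 a; have D0 := poisson_den_gt0 a z.
by rewrite /poisson ler_wpM2l ?(ltW k0)// lef_pV2 ?posrE ?poisson_den_le4.
Qed.

Lemma measurable_poisson_den :
  measurable_fun setT (fun z : circle R => poisson_den a z).
Proof.
under eq_fun do rewrite poisson_denE.
have mR := measurable_Re_circle; have mI := measurable_Im_circle.
apply: measurable_funD; apply: measurable_funX.
  apply: measurable_funB; last exact: measurable_funM.
  by apply: measurable_funB => //; exact: measurable_funM.
by apply: measurable_funB; exact: measurable_funM.
Qed.

Lemma measurable_poisson : measurable_fun setT (poisson a).
Proof.
apply: measurable_funM => //; apply: measurable_fun_inv_gt0.
  by move=> z; exact: poisson_den_gt0.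
exact: measurable_poisson_den.
Qed.

Lemma measurable_moebius : measurable_fun setT (moebius a).
Proof.
have mR := measurable_Re_circle; have mI := measurable_Im_circle.
have mD : measurable_fun setT (fun z : circle R => (poisson_den a z)^-1).
  apply: measurable_fun_inv_gt0; last exact: measurable_poisson_den.
  by move=> z; exact: poisson_den_gt0.
pose p := complex.Re (a : R[i]); pose s := complex.Im (a : R[i]).
pose re (z : circle R) := complex.Re (z : R[i]).
pose im (z : circle R) := complex.Im (z : R[i]).
pose v (z : circle R) := 1 - p * re z - s * im z.
pose n (z : circle R) := p * im z - s * re z.
have mv : measurable_fun setT v.
  apply: measurable_funB; last exact: measurable_funM.
  by apply: measurable_funB => //; exact: measurable_funM.
have mn : measurable_fun setT n.
  by apply: measurable_funB; exact: measurable_funM.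
pose X (z : circle R) := ((p - re z) * v z - (s - im z) * n z)
  * (poisson_den a z)^-1.
pose Y (z : circle R) := ((p - re z) * n z + (s - im z) * v z)
  * (poisson_den a z)^-1.
(* The quotient is reduced to a real denominator by the conjugate [v + i n]. *)
have moebiusE (z : circle R) : (moebius a z : R[i]) = (X z +i* Y z)%C.
  have w0 := one_sub_conj_mul_neq0 z; apply: (mulIf w0).
  rewrite /= /moebius_fun divfK//.
  have -> : 1 - (a : R[i])^* * (z : R[i]) = (v z -i* n z)%C.
    exact: one_sub_conj_mulE.
  have DE : poisson_den a z = v z ^+ 2 + n z ^+ 2 := poisson_denE a z.
  have := poisson_den_gt0 a z; rewrite /X /Y DE => D0.
  have -> : (a : R[i]) - (z : R[i]) = ((p - re z) +i* (s - im z))%C.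
    by rewrite /p /s /re /im; case: (a : R[i]) (z : R[i]) => x y [].
  apply/eqP; rewrite eq_complex /=.
  by apply/andP; split; apply/eqP; field; rewrite gt_eqF.
apply: measurable_fun_circle.
  rewrite (_ : (fun z => _) = X); last by apply/funext => z; rewrite moebiusE.
  apply: measurable_funM => //.
  by apply: measurable_funB; apply: measurable_funM => //; exact: measurable_funB.
rewrite (_ : (fun z => _) = Y); last by apply/funext => z; rewrite moebiusE.
apply: measurable_funM => //.
by apply: measurable_funD; apply: measurable_funM => //; exact: measurable_funB.
Qed.

(** Read on the line, both sides are, up to the factor [1 / (2 pi)], Lebesgue
    measures of the periodic set of the [t] with [e^(it)] in [A], over the period
    starting at 0 on the left and at [moebius_lift a 0] on the right. *)
Lemma circle_measure_moebius_preimage (A : set (circle R)) : measurable A ->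
  (mu A = \int[mu]_(z in moebius a @^-1` A) (poisson a z)%:E)%E.
Proof.
move=> mA.
have mpA : measurable (moebius a @^-1` A).
  by rewrite -[X in measurable X]setTI; exact: measurable_moebius.
have mS : measurable (@expi R @^-1` A).
  by rewrite -[X in measurable X]setTI; exact: measurable_expi.
have expiD (t : R) : expi (t + pi *+ 2) = expi t.
  by apply/val_inj; rewrite /= cosD2pi sinD2pi.
transitivity (((pi *+ 2)^-1)%:E *
    @lebesgue_measure R (expi @^-1` A `&` `]0%R, (pi *+ 2)%R]))%E.
  have -> : mu A = (\int[mu]_z (\1_A z)%:E)%E by rewrite integral_indic// setIT.
  rewrite integral_circle;
    [|exact/measurable_EFinP|by move=> z; rewrite lee_fin].
  by congr (_ * _)%E; rewrite -integral_indic//; apply: eq_integral => t _.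
rewrite integral_mkcond integral_circle; first last.
- by apply: erestrict_ge0 => z _; rewrite lee_fin ltW// poisson_gt0.
- apply/(measurable_restrictT _ mpA)/measurable_funTS/measurable_EFinP.
  exact: measurable_poisson.
congr (_ * _)%E.
have pi2 := pi2_gt0 (R := R).
have [l1 l2] := andP (moebius_lift_bounds a 0).
rewrite -(@lebesgue_measure_periodic _ (pi *+ 2) (moebius_lift a 0))//; last 2 first.
- by move=> t; rewrite /preimage /= expiD.
- by rewrite ltW// ltW// -[ltRHS]add0r.
rewrite -(@lebesgue_measure_substitution _ (moebius_lift a)).
- have -> : moebius_lift a @^-1` (@expi R @^-1` A `&`
        `]moebius_lift a 0, moebius_lift a 0 + pi *+ 2]) =
      `]0, pi *+ 2] `&` (moebius_lift a @^-1` (@expi R @^-1` A)).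
    rewrite preimage_setI setIC; congr (_ `&` _).
    have F_lt := leW_mono (le_mono (@moebius_lift_lt _ a)).
    have F_le := le_mono (@moebius_lift_lt _ a).
    rewrite -(moebius_liftD2pi a 0) add0r.
    by apply/seteqP; split => x /=; rewrite !in_itv /= F_lt F_le.
  rewrite derive1_moebius_lift integral_mkcondr.
  apply: eq_integral => t _; rewrite /patch /=.
  congr (if _ then _ else _).
  by apply/idP/idP; rewrite !inE /preimage /= expi_moebius_lift.
- exact: moebius_lift_lt.
- exact: moebius_lift_surj.
- exact: derivable_moebius_lift.
- by rewrite derive1_moebius_lift; exact: continuous_poisson_expi.
- by move=> t; rewrite derive1_moebius_lift ltW// poisson_gt0.
- exact: measurableI.
Qed.

(** The image of the circle measure under the involution [phi] has the Poisson
    kernel as its Radon-Nikodym derivative. *)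
Lemma ge0_integral_moebius (G : circle R -> \bar R) :
  measurable_fun setT G -> (forall z, 0 <= G z)%E ->
  (\int[mu]_z G (moebius a z) = \int[mu]_z (G z * (poisson a z)%:E))%E.
Proof.
move=> mG G0.
pose mphi_mixin := isMeasurableFun.Build _ _ _ _ _ measurable_moebius.
pose phi : {mfun circle R >-> circle R} := HB.pack (moebius a) mphi_mixin.
pose nu : probability (circle R) R := distribution mu phi.
have nuE A : measurable A -> (nu A = \int[mu]_(z in A) (poisson a z)%:E)%E.
  move=> mA; rewrite -[LHS]/(mu (moebius a @^-1` A)).
  rewrite circle_measure_moebius_preimage; last first.
    by rewrite -[X in measurable X]setTI; exact: measurable_moebius.
  congr (integral _ _ _).
  by apply/seteqP; split=> z /=; rewrite /preimage /= moebiusK.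
have nu_mu : nu `<< mu.
  apply/null_content_dominatesP => A mA A0; rewrite nuE//.
  apply: null_set_integral => //.
  by apply/measurable_funTS/measurable_EFinP; exact: measurable_poisson.
have dE : ae_eq mu setT (Radon_Nikodym_SigmaFinite.f nu mu) (EFin \o poisson a).
  apply: integral_ae_eq => //.
  - exact: Radon_Nikodym_SigmaFinite.f_integrable.
  - by apply/measurable_EFinP; exact: measurable_poisson.
  - move=> A _ mA; rewrite -Radon_Nikodym_SigmaFinite.f_integral//.
    exact: nuE.
transitivity (\int[nu]_z G z)%E.
  by rewrite [RHS]ge0_integral_pushforward// preimage_setT.
rewrite -(Radon_Nikodym_SigmaFinite.change_of_variables nu_mu)//.
apply: ae_eq_integral => //.
- apply: emeasurable_funM => //.
  exact: measurable_int (Radon_Nikodym_SigmaFinite.f_integrable nu_mu).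
- apply: emeasurable_funM => //; apply/measurable_EFinP.
  exact: measurable_poisson.
- exact: ae_eqe_mul2l dE.
Qed.

Lemma Rintegral_moebius (F : circle R -> R) : measurable_fun setT F ->
  \int[mu]_z F (moebius a z) = \int[mu]_z (F z * poisson a z).
Proof.
move=> mF; rewrite /Rintegral; congr fine.
have mFE : measurable_fun setT (EFin \o F) by exact/measurable_EFinP.
have p0 z : (0 <= (poisson a z)%:E)%E by rewrite lee_fin ltW// poisson_gt0.
have posE : (fun z => (F z * poisson a z)%:E)^\+%E =
    (fun z => (EFin \o F)^\+%E z * (poisson a z)%:E)%E.
  by apply/funext => z; rewrite !funeposE /= EFinM maxeMl// mul0e.
have negE : (fun z => (F z * poisson a z)%:E)^\-%E =
    (fun z => (EFin \o F)^\-%E z * (poisson a z)%:E)%E.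
  by apply/funext => z; rewrite !funenegE EFinM -mulNe maxeMl// mul0e.
rewrite [LHS]integralE [RHS]integralE posE negE.
rewrite -(@ge0_integral_moebius ((EFin \o F)^\+)%E)//;
  last exact: measurable_funepos.
rewrite -(@ge0_integral_moebius ((EFin \o F)^\-)%E)//;
  last exact: measurable_funeneg.
by congr (_ - _)%E; apply: eq_integral => z _; rewrite ?funeposE ?funenegE.
Qed.

End MoebiusChangeOfVariables.

(** * Square-integrable functions *)

Section SquareIntegrable.
Context {R : realType}.
Local Notation mu := (circle_measure R).
Local Notation Re := complex.Re.
Local Notation Im := complex.Im.
Implicit Types (f g h : cfun R) (x y : R[i]).

(** The square bears on the real number [Re |x|], as in the integrands of [L2]
    and [L2norm], to which [sqn] is convertible. *)
Definition sqn (x : R[i]) : R := Re `|x| ^+ 2.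

Lemma sqnE x : sqn x = Re x ^+ 2 + Im x ^+ 2. 
Proof. by rewrite /sqn normc_def /= sqr_sqrtr// addr_ge0 ?sqr_ge0. Qed.

Lemma sqn_ge0 x : 0 <= sqn x. Proof. exact: sqr_ge0. Qed.

Lemma sqn_eq0 x : sqn x = 0 -> x = 0.
Proof.
case: x => u v /eqP; rewrite sqnE /= paddr_eq0 ?sqr_ge0// !sqrf_eq0.
by move=> /andP[/eqP -> /eqP ->].
Qed.

Lemma sqnD x y : sqn (x + y) <= 2 * sqn x + 2 * sqn y.
Proof.
case: x y => u v [w t]; rewrite !sqnE /=.
by have := sqr_ge0 (u - w); have := sqr_ge0 (v - t); nra.
Qed.

Lemma sqn_realM (k : R) x : sqn (k%:C%C * x) = k ^+ 2 * sqn x.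
Proof. by case: x => u v; rewrite !sqnE /=; ring. Qed.

Lemma integrable_addr (F G : circle R -> R) :
  mu.-integrable setT (EFin \o F) -> mu.-integrable setT (EFin \o G) ->
  mu.-integrable setT (EFin \o (fun z => F z + G z)).
Proof. by move=> iF iG; exact: (integrableD measurableT iF iG). Qed.

Lemma integrable_mull (c : R) (F : circle R -> R) :
  mu.-integrable setT (EFin \o F) ->
  mu.-integrable setT (EFin \o (fun z => c * F z)).
Proof. by move=> iF; exact: (integrableZl measurableT c iF). Qed.

Lemma L2_measurable_sqn f : L2 f -> measurable_fun setT (fun z => sqn (f z)).
Proof.
move=> [mR mI _]; under eq_fun do rewrite sqnE.
by apply: measurable_funD; exact: measurable_funX.
Qed.

Lemma L2_integrable f :
  L2 f -> mu.-integrable setT (EFin \o (fun z => sqn (f z))).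
Proof.
move=> f2; apply/integrableP; split.
  exact/measurable_EFinP/L2_measurable_sqn.
have [_ _] := f2; congr (_ < _)%E; apply: eq_integral => z _.
have s0 : (0 <= (sqn (f z))%:E)%E by rewrite lee_fin sqn_ge0.
exact: (esym (gee0_abs s0)).
Qed.

Lemma L2_le f (G : circle R -> R) : measurable_fun setT (fun z => Re (f z)) ->
  measurable_fun setT (fun z => Im (f z)) ->
  mu.-integrable setT (EFin \o G) -> (forall z, sqn (f z) <= G z) -> L2 f.
Proof.
move=> mR mI iG le; split=> //.
apply: (@le_lt_trans _ _ (\int[mu]_z (G z)%:E)%E); last first.
  exact: integrable_lty iG.
apply: ge0_le_integral => //.
- by move=> z ?; rewrite lee_fin sqn_ge0.
- apply/measurable_EFinP.
  rewrite (_ : (fun z => _) = (fun z => Re (f z) ^+ 2 + Im (f z) ^+ 2)).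
    by apply: measurable_funD; exact: measurable_funX.
  by apply/funext => z; exact: sqnE.
- exact: measurable_int iG.
- by move=> z ?; rewrite lee_fin; exact: le.
Qed.

Lemma L2D f g : L2 f -> L2 g -> L2 (fun z => f z + g z).
Proof.
move=> f2 g2; have [fR fI _] := f2; have [gR gI _] := g2.
apply: (@L2_le _ (fun z => 2 * sqn (f z) + 2 * sqn (g z))).
- rewrite (_ : (fun z => _) = (fun z => Re (f z) + Re (g z))).
    exact: measurable_funD.
  by apply/funext => z; case: (f z) (g z) => ? ? [].
- rewrite (_ : (fun z => _) = (fun z => Im (f z) + Im (g z))).
    exact: measurable_funD.
  by apply/funext => z; case: (f z) (g z) => ? ? [].
- by apply: integrable_addr; apply: integrable_mull; exact: L2_integrable.
- by move=> z; exact: sqnD.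
Qed.

(** Multiplication operators are taken with real symbols: these are self-adjoint,
    and the Poisson kernel and its powers are real. *)
Definition rmul (k : circle R -> R) f : cfun R := fun z => (k z)%:C%C * f z.

Lemma L2_rmul (k : circle R -> R) (M : R) f : measurable_fun setT k ->
  (forall z, `|k z| <= M) -> L2 f -> L2 (rmul k f).
Proof.
move=> mk kM f2; have [fR fI _] := f2.
apply: (@L2_le _ (fun z => M ^+ 2 * sqn (f z))).
- rewrite (_ : (fun z => _) = (fun z => k z * Re (f z))).
    exact: measurable_funM.
  apply/funext => z; rewrite /rmul.
  by case: (f z) => ? ? /=; rewrite mul0r subr0.
- rewrite (_ : (fun z => _) = (fun z => k z * Im (f z))).
    exact: measurable_funM.
  apply/funext => z; rewrite /rmul.
  by case: (f z) => ? ? /=; rewrite mul0r addr0.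
- exact/integrable_mull/L2_integrable.
- move=> z; rewrite sqn_realM ler_wpM2r ?sqn_ge0//.
  rewrite -[leLHS]real_normK ?num_real//.
  by rewrite lerXn2r// ?nnegrE// (le_trans _ (kM z)).
Qed.

Lemma L2_cst_rmul (k : R) f : L2 f -> L2 (fun z => k%:C%C * f z).
Proof.
by move=> f2; apply: (@L2_rmul (cst k) `|k|) => //; exact: measurable_cst.
Qed.

(** By change of variables, [|f o phi|^2] has the integral of [|f|^2] against the
    bounded Poisson kernel. *)
Lemma L2_composition (a : disk R) f : L2 f -> L2 (composition a f).
Proof.
move=> f2; have [fR fI fi] := f2; split.
- exact: (measurableT_comp fR (measurable_moebius a)).
- exact: (measurableT_comp fI (measurable_moebius a)).
pose G z := (sqn (f z))%:E.
rewrite (ge0_integral_moebius a (G := G)); last 2 first.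
- exact/measurable_EFinP/L2_measurable_sqn.
- by move=> z; rewrite lee_fin sqn_ge0.
have iZ : mu.-integrable setT
    (EFin \o (fun z => 4 / poisson_num a * sqn (f z))).
  exact/integrable_mull/L2_integrable.
apply: le_lt_trans (integrable_lty measurableT iZ).
apply: ge0_le_integral => //.
- by move=> z ?; rewrite mule_ge0 ?lee_fin ?sqn_ge0 ?ltW// poisson_gt0.
- apply: emeasurable_funM; last exact/measurable_EFinP/measurable_poisson.
  exact/measurable_EFinP/L2_measurable_sqn.
- exact: measurable_int iZ.
- move=> z ?; rewrite /G /= -EFinM lee_fin mulrC ler_wpM2r ?sqn_ge0//.
  exact: poisson_le.
Qed.

Definition sqnorm f : R := \int[mu]_z sqn (f z).

Lemma sqnorm_ge0 f : 0 <= sqnorm f.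
Proof. by apply: Rintegral_ge0 => z _; exact: sqn_ge0. Qed.

Lemma sqnorm_ae f g : L2 f -> L2 g -> f = g %[ae mu] -> sqnorm f = sqnorm g.
Proof.
move=> f2 g2 fg; congr fine; apply: ae_eq_integral => //.
- exact/measurable_EFinP/L2_measurable_sqn.
- exact/measurable_EFinP/L2_measurable_sqn.
- by apply: filterS fg => z fgz _; rewrite /= fgz.
Qed.

Lemma sqnorm_eq0 f : L2 f -> sqnorm f = 0 -> f = (0 : cfun R) %[ae mu].
Proof.
move=> f2 f0; have iF := L2_integrable f2.
have i0 : (\int[mu]_z `|(EFin \o (fun z => sqn (f z))) z| = 0)%E.
  have -> : (\int[mu]_z `|(EFin \o (fun z => sqn (f z))) z| =
      \int[mu]_z (sqn (f z))%:E)%E.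
    apply: eq_integral => z _; apply: (gee0_abs (x := (sqn (f z))%:E)).
    by rewrite lee_fin; exact: sqn_ge0.
  by rewrite -[LHS]fineK ?[fine _]f0//; exact: integrable_fin_num iF.
have := (ae_eq_integral_abs mu measurableT (measurable_int mu iF)).1 i0.
by apply: filterS => z /(_ I) [] /sqn_eq0 fz _.
Qed.

Lemma sqnormD f g : L2 f -> L2 g ->
  sqnorm (fun z => f z + g z) <= 2 * sqnorm f + 2 * sqnorm g.
Proof.
move=> f2 g2; rewrite /sqnorm.
have iF := L2_integrable f2; have iG := L2_integrable g2.
rewrite -!RintegralZl// -RintegralD//; [|exact: integrable_mull..].
apply: le_Rintegral => //.
- exact: (L2_integrable (L2D f2 g2)).
- by apply: integrable_addr; exact: integrable_mull.
- by move=> z _; exact: sqnD.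
Qed.

Lemma sqnorm_rmul (k : circle R -> R) (M : R) f : measurable_fun setT k ->
  (forall z, `|k z| <= M) -> L2 f -> sqnorm (rmul k f) <= M ^+ 2 * sqnorm f.
Proof.
move=> mk kM f2; rewrite -RintegralZl//; last exact: L2_integrable.
apply: le_Rintegral => //.
- exact: (L2_integrable (L2_rmul mk kM f2)).
- exact/integrable_mull/L2_integrable.
- move=> z _; rewrite sqn_realM ler_wpM2r ?sqn_ge0//.
  rewrite -[leLHS]real_normK ?num_real//.
  by rewrite lerXn2r// ?nnegrE// (le_trans _ (kM z)).
Qed.

Definition rdot x y : R := Re (x * y^*).

Lemma rdotE x y : rdot x y = Re x * Re y + Im x * Im y.
Proof. by case: x y => u v [w t]; rewrite /rdot /= mulrN opprK. Qed.

Lemma rdot_integrable f g : L2 f -> L2 g ->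
  mu.-integrable setT (EFin \o (fun z => rdot (f z) (g z))).
Proof.
move=> f2 g2; have [fR fI _] := f2; have [gR gI _] := g2.
apply: (@le_integrable _ _ _ _ _ measurableT _
  (EFin \o (fun z => sqn (f z) + sqn (g z)))).
- apply/measurable_EFinP; under eq_fun do rewrite rdotE.
  by apply: measurable_funD; exact: measurable_funM.
- move=> z _; rewrite lee_fin ler_norml ger0_norm ?addr_ge0 ?sqn_ge0//.
  rewrite !sqnE rdotE.
  case: (f z) (g z) => u v [w t] /=.
  have := sqr_ge0 (u - w); have := sqr_ge0 (v - t).
  have := sqr_ge0 (u + w); have := sqr_ge0 (v + t).
  by move=> *; apply/andP; split; nra.
- by apply: integrable_addr; exact: L2_integrable.
Qed.

Lemma Re_inner f g : Re (inner f g) = \int[mu]_z rdot (f z) (g z).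
Proof. by []. Qed.

End SquareIntegrable.

(** * Uniqueness of the positive square root of a multiplication operator *)

Section SquareRoot.
Context {R : realType}.
Local Notation mu := (circle_measure R).
Implicit Types (f g u : cfun R).

Variables (P : operator R) (q : circle R -> R) (m L : R).
Hypothesis P_ge0 : positive_operator P.
Hypothesis mq : measurable_fun setT q.
Hypothesis m_gt0 : 0 < m.
Hypothesis q_ge : forall z, m <= q z.
Hypothesis q_le : forall z, q z <= L.
Hypothesis P_sqr : forall f, L2 f ->
  P (P f) = rmul (fun z => q z ^+ 2) f %[ae mu].

Let P_L2 f : L2 f -> L2 (P f).
Proof. by have [[+ _ _ _] _] := P_ge0; exact. Qed.

Let L_gt0 : 0 < L.
Proof. exact: lt_le_trans m_gt0 (le_trans (q_ge point) (q_le point)). Qed.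

Let neg_q_le z : `|- q z| <= L.
Proof. by rewrite normrN ger0_norm// (le_trans (ltW m_gt0)). Qed.

Let gap_le z : `|L - q z| <= L - m.
Proof. by rewrite ger0_norm ?subr_ge0// lerD2l lerN2. Qed.

Let gap f : cfun R := rmul (fun z => L - q z) f.

Let gap_L2 f : L2 f -> L2 (gap f).
Proof. by apply: L2_rmul gap_le; exact: measurable_funB. Qed.

Let minus_q_L2 f : L2 f -> L2 (rmul (fun z => - q z) f).
Proof. by apply: L2_rmul neg_q_le; exact: measurableT_comp. Qed.

Definition root_defect f : cfun R := fun z => P f z + rmul (fun z => - q z) f z.

Let defect_L2 f : L2 f -> L2 (root_defect f).
Proof. by move=> f2; apply: L2D; [exact: P_L2|exact: minus_q_L2]. Qed.

(** The identity [D (L - q) = (L + P) D]: on both sides the terms in [P (q f)]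
    cancel, and what is left agrees because [P P = q ^ 2]. *)
Lemma root_defect_gap f : L2 f ->
  root_defect (gap f) =
    (fun z => L%:C%C * root_defect f z + P (root_defect f) z) %[ae mu].
Proof.
move=> f2; have [[_ _ P_lin _] _] := P_ge0.
pose k := rmul (fun z => - q z) f.
have k2 : L2 k by exact: minus_q_L2.
have gapE : gap f = (fun z => L%:C%C * f z + k z).
  by apply/funext => z; rewrite /gap /k /rmul rmorphB rmorphN /= -mulrDl.
have defE : root_defect f = (fun z => 1 * P f z + k z).
  by apply/funext => z; rewrite mul1r.
have h1 := P_lin L%:C%C _ _ f2 k2.
have h2 := P_lin 1 _ _ (P_L2 f2) k2.
apply: filterS3 h1 h2 (P_sqr f2) => z /(_ I) e1 /(_ I) e2 /(_ I) e3 _.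
rewrite {1}/root_defect {1}gapE e1 {2}defE e2 e3.
rewrite /root_defect /k /gap /rmul !rmorphN rmorphB rmorphXn /=; ring.
Qed.

(** [|L u + P u|^2 = L^2 |u|^2 + 2 L (P u, u) + |P u|^2], where the last two terms
    are nonnegative. *)
Lemma sqnorm_add_positive u : L2 u ->
  L ^+ 2 * sqnorm u <= sqnorm (fun z => L%:C%C * u z + P u z).
Proof.
move=> u2; have Pu2 := P_L2 u2; have [_ Ppos] := P_ge0.
have i1 := integrable_mull (L ^+ 2) (L2_integrable u2).
have i2 := integrable_mull (2 * L) (rdot_integrable Pu2 u2).
apply: (@le_trans _ _
  (\int[mu]_z (L ^+ 2 * sqn (u z) + 2 * L * rdot (P u z) (u z)))).
  rewrite RintegralD// !RintegralZl//;
    [|exact: rdot_integrable|exact: L2_integrable].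
  rewrite lerDl mulr_ge0 ?mulr_ge0 ?(ltW L_gt0)// -Re_inner.
  by have := Ppos _ u2; rewrite lecE => /andP[].
apply: le_Rintegral => //.
- exact: integrable_addr.
- by apply: L2_integrable; apply: L2D => //; exact: L2_cst_rmul.
move=> z _; case: (u z) (P u z) => x y [s t]; rewrite !sqnE rdotE /=.
by have := sqr_ge0 s; have := sqr_ge0 t; nra.
Qed.

Lemma sqnorm_defect_gap f : L2 f ->
  L ^+ 2 * sqnorm (root_defect f) <= sqnorm (root_defect (gap f)).
Proof.
move=> f2; have d2 := defect_L2 f2.
rewrite (sqnorm_ae _ _ (root_defect_gap f2)).
- exact: sqnorm_add_positive.
- exact/defect_L2/gap_L2.
- by apply: L2D; [exact: L2_cst_rmul|exact: P_L2].
Qed.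

Lemma sqnorm_defect_le :
  exists2 C : R, 0 <= C &
    forall f, L2 f -> sqnorm (root_defect f) <= C * sqnorm f.
Proof.
have [[_ _ _ [M PM]] _] := P_ge0.
exists (2 * M ^+ 2 + 2 * L ^+ 2) => [|f f2].
  by rewrite addr_ge0// mulr_ge0// sqr_ge0.
apply: le_trans (sqnormD (P_L2 f2) (minus_q_L2 f2)) _.
have h1 : sqnorm (P f) <= M ^+ 2 * sqnorm f.
  have := PM _ f2; rewrite /L2norm -/(sqnorm _) -/(sqnorm f) => le.
  rewrite -[leLHS]sqr_sqrtr ?sqnorm_ge0// -[X in _ * X]sqr_sqrtr ?sqnorm_ge0//.
  by rewrite -exprMn lerXn2r// ?nnegrE ?sqrtr_ge0// (le_trans _ le).
have mNq : measurable_fun setT (fun z => - q z) by exact: measurableT_comp.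
have h2 := sqnorm_rmul mNq neg_q_le f2.
rewrite (mulrDl (2 * M ^+ 2)) -(mulrA 2 (M ^+ 2)) -(mulrA 2 (L ^+ 2)).
by apply: lerD; apply: ler_wpM2l.
Qed.

Lemma sqnorm_defect_iter f n : L2 f ->
  L2 (iter n gap f) /\
  L ^+ 2 ^+ n * sqnorm (root_defect f) <= sqnorm (root_defect (iter n gap f)) /\
  sqnorm (iter n gap f) <= (L - m) ^+ 2 ^+ n * sqnorm f.
Proof.
move=> f2; elim: n => [|n [g2 [IH1 IH2]]]; first by rewrite !expr0 !mul1r.
split; first exact: gap_L2.
split.
  rewrite exprS -mulrA; apply: le_trans (sqnorm_defect_gap g2).
  by rewrite ler_wpM2l// sqr_ge0.
have mgap : measurable_fun setT (fun z => L - q z) by exact: measurable_funB.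
rewrite exprS -mulrA; apply: le_trans (sqnorm_rmul mgap gap_le g2) _.
by rewrite ler_wpM2l// sqr_ge0.
Qed.

(** Iterating the identity for [D] compares [L ^ n] with [(L - m) ^ n], and
    [0 <= L - m < L]. *)
Lemma sqnorm_defect_eq0 f : L2 f -> sqnorm (root_defect f) = 0.
Proof.
move=> f2; have [C C0 DC] := sqnorm_defect_le.
pose r := ((L - m) / L) ^+ 2.
have Lm : 0 <= L - m by rewrite (le_trans _ (gap_le point)).
have r0 : 0 <= r by exact: sqr_ge0.
have r1 : r < 1.
  rewrite expr_lt1 ?divr_ge0// ?(ltW L_gt0)//.
  by rewrite ltr_pdivrMr// mul1r gtrBl.
apply/eqP; rewrite eq_le sqnorm_ge0 andbT.
have bound n : sqnorm (root_defect f) <= C * sqnorm f * r ^+ n.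
  have [g2 [h1 h2]] := sqnorm_defect_iter n f2.
  have L2n : 0 < L ^+ 2 ^+ n by rewrite !exprn_gt0.
  rewrite /r !expr_div_n mulrA ler_pdivlMr// [leLHS]mulrC (le_trans h1)//.
  rewrite (le_trans (DC _ g2))// -mulrA ler_wpM2l//.
  by rewrite [leRHS]mulrC.
have cv : geometric (C * sqnorm f) r n @[n --> \oo] --> (0 : R).
  by apply: cvg_geometric; rewrite ger0_norm.
rewrite -(cvg_lim _ cv)//; apply: limr_ge; first by apply/cvg_ex; exists 0.
exact: nearW.
Qed.

Theorem positive_square_root_unique f : L2 f -> P f = rmul q f %[ae mu].
Proof.
move=> f2; have := sqnorm_eq0 (defect_L2 f2) (sqnorm_defect_eq0 f2).
apply: filterS => z /(_ I) e _; apply/eqP; rewrite -subr_eq0; apply/eqP.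
by move: e; rewrite /root_defect /rmul rmorphN /= mulNr.
Qed.

End SquareRoot.

(** * The polar part of the composition operator *)

Section PolarPart.
Context {R : realType}.
Variable a : disk R.
Local Notation mu := (circle_measure R).
Implicit Types (f g u : cfun R).

(** For every [u], [(u, B (C f)) = (C u, C f)] is the integral of [u (conj f)] against
    the Poisson kernel; taking for [u] the difference of the two sides of the
    claim shows that its norm is zero. *)
Lemma adjoint_composition (B : operator R) f : is_adjoint (composition a) B ->
  L2 f -> B (composition a f) = rmul (poisson a) f %[ae mu].
Proof.
move=> [[B_L2 _ _ _] B_adj] f2.
have Cf2 := L2_composition a f2; have BCf2 := B_L2 _ Cf2.
have poisson_norm z : `|poisson a z| <= 4 / poisson_num a.
  by rewrite ger0_norm ?poisson_le// ltW// poisson_gt0.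
have hf2 := L2_rmul (measurable_poisson a) poisson_norm f2.
pose u : cfun R := fun z =>
  B (composition a f) z + rmul (cst (-1)) (rmul (poisson a) f) z.
have u2 : L2 u.
  apply: L2D => //; apply: (L2_rmul (M := 1)) => //.
  by move=> z; rewrite normrN normr1.
have e : \int[mu]_z rdot (u z) (B (composition a f) z) =
         \int[mu]_z rdot (u z) (rmul (poisson a) f z).
  rewrite -Re_inner -B_adj// Re_inner.
  rewrite (@Rintegral_moebius _ a (fun z => rdot (u z) (f z))).
    apply: eq_Rintegral => z _; rewrite !rdotE /rmul.
    by case: (u z) (f z) => x y [s t] /=; ring.
  exact/measurable_EFinP/(measurable_int mu)/rdot_integrable.
have u0 : sqnorm u = 0.
  transitivity (\int[mu]_z (rdot (u z) (B (composition a f) z) -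
      rdot (u z) (rmul (poisson a) f z))).
    apply: eq_Rintegral => z _; rewrite sqnE !rdotE {2 4}/u /u /rmul.
    by case: (B _ z) (f z) => x y [s t] /=; ring.
  by rewrite RintegralB// ?e ?subrr//; exact: rdot_integrable.
apply: filterS (sqnorm_eq0 u2 u0) => z /(_ I) uz _.
apply/eqP; rewrite -subr_eq0; apply/eqP; move: uz.
by rewrite /u {1}/rmul rmorphN rmorph1 mulN1r.
Qed.

Definition sqrt_poisson (z : circle R) : R := Num.sqrt (poisson a z).

Lemma sqrt_poisson_gt0 z : 0 < sqrt_poisson z.
Proof. by rewrite sqrtr_gt0 poisson_gt0. Qed.

Lemma measurable_sqrt : measurable_fun setT (@Num.sqrt R).
Proof. by apply: continuous_measurable_fun; exact: sqrt_continuous. Qed.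

Lemma measurable_sqrt_poisson : measurable_fun setT sqrt_poisson.
Proof.
exact: (measurableT_comp measurable_sqrt (measurable_poisson a)).
Qed.

Lemma sqrt_poisson_le z : sqrt_poisson z <= Num.sqrt (4 / poisson_num a).
Proof. by rewrite ler_wsqrtr// poisson_le. Qed.

Lemma sqrt_poisson_ge z : Num.sqrt (poisson_num a / 4) <= sqrt_poisson z.
Proof. by rewrite ler_wsqrtr// poisson_ge. Qed.

Lemma sqrt_poisson_moebius z : sqrt_poisson (moebius a z) = (sqrt_poisson z)^-1.
Proof.
have k0 := poisson_num_gt0 a; have D0 := poisson_den_gt0 a z.
rewrite /sqrt_poisson -sqrtrV ?ltW ?poisson_gt0//.
by rewrite /poisson poisson_den_moebius; congr Num.sqrt; field; rewrite !gt_eqF.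
Qed.

Lemma modulus_composition (P : operator R) f : is_modulus (composition a) P ->
  L2 f -> P f = rmul sqrt_poisson f %[ae mu].
Proof.
move=> [P_ge0 [B B_adj PPE]] f2.
have k0 := poisson_num_gt0 a.
apply: (positive_square_root_unique P_ge0 measurable_sqrt_poisson _
  sqrt_poisson_ge sqrt_poisson_le) f2.
  by rewrite sqrtr_gt0 divr_gt0.
move=> g g2; apply: filterS2 (PPE _ g2) (adjoint_composition B_adj g2).
move=> z /(_ I) e1 /(_ I) e2 _; rewrite e1 e2.
by rewrite /rmul /sqrt_poisson sqr_sqrtr// ltW// poisson_gt0.
Qed.

(** The modulus [P] is invertible: [g = P (g / q)], hence the polar part sends [g]
    to [(g / q) o phi], and [q o phi = 1 / q]. *)
Lemma polar_unitary_partE (Ra : operator R) g :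
  polar_unitary_part (composition a) Ra -> L2 g ->
  Ra g = rmul sqrt_poisson (composition a g) %[ae mu].
Proof.
move=> [[[_ Ra_ae _ _] _] [P P_mod CE]] g2.
pose f : cfun R := rmul (fun z => (sqrt_poisson z)^-1) g.
have q0 z : sqrt_poisson z != 0 by rewrite gt_eqF// sqrt_poisson_gt0.
have f2 : L2 f.
  apply: (L2_rmul (M := Num.sqrt (4 / poisson_num a))) g2.
    by apply: measurable_fun_inv_gt0;
      [exact: sqrt_poisson_gt0|exact: measurable_sqrt_poisson].
  move=> z; rewrite -sqrt_poisson_moebius ger0_norm ?sqrt_poisson_le//.
  exact/ltW/sqrt_poisson_gt0.
have Pf : P f = g %[ae mu].
  apply: filterS (modulus_composition P_mod f2) => z /(_ I) -> _.
  by rewrite /f /rmul mulrA -rmorphM /= divff// mul1r.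
have Pf2 : L2 (P f) by case: P_mod => -[[P_L2 _ _ _] _] _; exact: P_L2.
apply: filterS2 (CE _ f2) (Ra_ae _ _ Pf2 g2 Pf) => z /(_ I) e1 /(_ I) e2 _.
by rewrite -e2 -e1 /f /rmul /composition /= sqrt_poisson_moebius invrK.
Qed.

(** The weight [|1 - conj a z|^(1/2)], as a real number. *)
Definition sqrt_dist (z : circle R) : R :=
  Num.sqrt (Num.sqrt (poisson_den a z)).

Lemma sqrt_distE (z : circle R) :
  sqrtC `|1 - (a : R[i])^* * (z : R[i])| = (sqrt_dist z)%:C%C.
Proof.
have s0 : 0 <= (sqrt_dist z)%:C%C :> R[i] by rewrite ler0c sqrtr_ge0.
rewrite -[RHS]sqrCK//; congr sqrtC.
rewrite -rmorphXn /= sqr_sqrtr ?sqrtr_ge0//.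
by rewrite [LHS]normc_def /poisson_den Re_sqr_norm.
Qed.

Lemma sqrt_dist_gt0 z : 0 < sqrt_dist z.
Proof. by rewrite !sqrtr_gt0 poisson_den_gt0. Qed.

Lemma sqrt_dist_moebius z :
  sqrt_dist (moebius a z) = sqrt_poisson z * sqrt_dist z.
Proof.
have k0 := poisson_num_gt0 a; have D0 := poisson_den_gt0 a z.
rewrite /sqrt_dist /sqrt_poisson -sqrtrM ?ltW ?poisson_gt0//; congr Num.sqrt.
have sD0 : 0 < Num.sqrt (poisson_den a z) by rewrite sqrtr_gt0.
rewrite poisson_den_moebius sqrtrM ?sqr_ge0// sqrtr_sqr ger0_norm ?ltW//.
have -> : poisson a z = poisson_num a / Num.sqrt (poisson_den a z) ^+ 2.
  by rewrite sqr_sqrtr ?ltW.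
rewrite sqrtrV ?ltW//.
by field; rewrite gt_eqF.
Qed.

Lemma L2_sqrt_dist f : L2 f -> L2 (rmul sqrt_dist f).
Proof.
apply: (L2_rmul (M := Num.sqrt (Num.sqrt 4))).
  exact: (measurableT_comp measurable_sqrt
    (measurableT_comp measurable_sqrt (measurable_poisson_den a))).
by move=> z; rewrite ger0_norm ?ler_wsqrtr ?poisson_den_le4 ?ltW ?sqrt_dist_gt0.
Qed.

(** Multiplication by the weight turns [Ra f + e f] into the same expression for
    the composition operator, because [sqrt_dist o phi = q * sqrt_dist]. *)
Lemma polar_unitary_part_eigen (Ra : operator R) (e : R[i]) f :
  polar_unitary_part (composition a) Ra -> L2 f ->
  (fun z => Ra f z + e * f z) = (0 : cfun R) %[ae mu] <->
  (fun z => composition a (rmul sqrt_dist f) z + e * rmul sqrt_dist f z)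
    = (0 : cfun R) %[ae mu].
Proof.
move=> Ra_polar f2; have RaE := polar_unitary_partE Ra_polar f2.
have intertwine z :
  composition a (rmul sqrt_dist f) z + e * rmul sqrt_dist f z =
    (sqrt_dist z)%:C%C * (rmul sqrt_poisson (composition a f) z + e * f z).
  by rewrite /composition /rmul /= sqrt_dist_moebius rmorphM /=; ring.
have d0 z : (sqrt_dist z)%:C%C != 0 :> R[i].
  by rewrite -[0]/(0%:C)%C (inj_eq (@complexI R)) gt_eqF// sqrt_dist_gt0.
split=> H; apply: filterS2 RaE H => z /(_ I) RaEz /(_ I) Hz _.
  by rewrite intertwine -RaEz Hz mulr0.
apply: (mulfI (d0 z)); rewrite RaEz -intertwine Hz.
by rewrite mulr0.
Qed.

End PolarPart.

Unset Implicit Arguments.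

Theorem proposition3p5 (R : realType) (a : disk R) (Ra : operator R)
    (Ra_polar : polar_unitary_part (composition a) Ra)
    (f g : cfun R) (f_L2 : L2 f) (g_L2 : L2 g) :
  (nullspace (Ra - idfun) f <->
   nullspace (composition a - idfun)
     (fun z => sqrtC `|1 - (a : R[i])^* * (z : R[i])| * f z)) /\
  (nullspace (Ra + idfun) g <->
   nullspace (composition a + idfun)
     (fun z => sqrtC `|1 - (a : R[i])^* * (z : R[i])| * g z)).
Proof.
have weightE h :
  (fun z : circle R => sqrtC `|1 - (a : R[i])^* * (z : R[i])| * h z) =
    rmul (sqrt_dist a) h.
  by apply/funext => z; rewrite sqrt_distE.
rewrite !weightE.
have L2f := L2_sqrt_dist a f_L2; have L2g := L2_sqrt_dist a g_L2.
have ef := polar_unitary_part_eigen (-1) Ra_polar f_L2.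
have eg := polar_unitary_part_eigen 1 Ra_polar g_L2.
have subE (A : operator R) h : (A - idfun) h = (fun z => A h z + -1 * h z).
  by apply/funext => z; rewrite mulN1r.
have addE (A : operator R) h : (A + idfun) h = (fun z => A h z + 1 * h z).
  by apply/funext => z; rewrite mul1r.
by split; split; rewrite /nullspace /= ?subE ?addE; move=> [_ H]; split => //;
  [exact/ef|exact/ef|exact/eg|exact/eg].
Qed.
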